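(* Let $n\ge 1$ and let $\lambda=(\lambda_1,\dots,\lambda_n)\in\mathbb{R}^n$ with $0<\lambda_1\le\dots\le\lambda_n$. Every $2$-local $\frac12$-derivation of the oscillator Lie algebra $\mathfrak{L}_\lambda$ is a $\frac12$-derivation.
   Context: All algebras are over $\mathbb{C}$. A linear map $D:\mathfrak{L}\to\mathfrak{L}$ on a Lie algebra is a $\frac12$-derivation if $D[x,y]=\frac12\big([D(x),y]+[x,D(y)]\big)$ for all $x,y\in\mathfrak{L}$. A map $\nabla:\mathfrak{L}\to\mathfrak{L}$ (not necessarily linear) is a $2$-local $\frac12$-derivation if for all $x,y\in\mathfrak{L}$ there is a $\frac12$-derivation $D_{x,y}$ with $\nabla(x)=D_{x,y}(x)$ and $\nabla(y)=D_{x,y}(y)$. The oscillator Lie algebra $\mathfrak{L}_\lambda$ is the $(2n+2)$-dimensional Lie algebra with basis $\{e_{-1},e_0,e_j,\check{e}_j\}_{j=1,\dots,n}$ and brackets $[e_{-1},e_j]=\lambda_j\check{e}_j$, $[e_{-1},\check{e}_j]=-\lambda_je_j$, $[e_j,\check{e}_j]=e_0$ for $j=1,\dots,n$; brackets of basis elements not obtained from these by antisymmetry are zero. *)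

(* Defs.v *)
From HB Require Import structures.
From mathcomp Require Import all_boot all_order all_algebra.
From mathcomp Require Import reals complex.

Set Implicit Arguments.
Unset Strict Implicit.
Unset Printing Implicit Defensive.

Import GRing.Theory Num.Theory.
Local Open Scope ring_scope.

HB.mixin Record Lmodule_isLieAlgebra (F : fieldType) L
    of GRing.Lmodule F L := {
  lie : L -> L -> L;
  lie_linearl : forall y, linear (lie^~ y);
  lie_linearr : forall x, linear (lie x);
  liexx : forall x, lie x x = 0;
  lie_jacobi : forall x y z,
    lie x (lie y z) + lie y (lie z x) + lie z (lie x y) = 0
}.

#[short(type="lieAlgType")]
HB.structure Definition LieAlgebra (F : fieldType) :=
  {L of GRing.Lmodule F L & Lmodule_isLieAlgebra F L}.

Notation "[[ x , y ]]" := (lie x y)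
  (at level 0, x at level 99, y at level 99, format "[[ x ,  y ]]")
  : ring_scope.

Definition half_derivation (F : numFieldType) (L : lieAlgType F)
    (D : L -> L) : Prop :=
  linear D /\
  forall x y, D [[x, y]] = 2^-1 *: ([[D x, y]] + [[x, D y]]).

Definition two_local_half_derivation (F : numFieldType) (L : lieAlgType F)
    (nabla : L -> L) : Prop :=
  forall x y, exists D : L -> L,
    [/\ half_derivation D, nabla x = D x & nabla y = D y].

(* Labels of the 2n+2 basis vectors: Em1, E0, Ej j, Ec j stand for
   e_{-1}, e_0, e_j, \check e_j; the index j ranges over 0, ..., n-1. *)
Inductive osc_index (n : nat) : Type :=
  Em1 | E0 | Ej of 'I_n | Ec of 'I_n.
Arguments Em1 {n}.
Arguments E0 {n}.

Section OscIndexFinite.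
Variable n : nat.

Definition osc_index_code (a : osc_index n) : option (option ('I_n + 'I_n)) :=
  match a with
  | Em1 => None
  | E0 => Some None
  | Ej j => Some (Some (inl j))
  | Ec j => Some (Some (inr j))
  end.

Definition osc_index_decode (c : option (option ('I_n + 'I_n))) : osc_index n :=
  match c with
  | None => Em1
  | Some None => E0
  | Some (Some (inl j)) => Ej j
  | Some (Some (inr j)) => Ec j
  end.

Lemma osc_index_codeK : cancel osc_index_code osc_index_decode.
Proof. by case. Qed.

HB.instance Definition _ := Finite.copy (osc_index n) (can_type osc_index_codeK).

End OscIndexFinite.

Section OscTable.
Variables (F : fieldType) (V : lmodType F) (n : nat).
Variables (lam : 'I_n -> F) (e : osc_index n -> V).

Definition osc_bracket_table (a b : osc_index n) : V :=
  match a, b with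
  | Em1, Ej j => lam j *: e (Ec j)
  | Ej j, Em1 => - (lam j *: e (Ec j))
  | Em1, Ec j => - lam j *: e (Ej j)
  | Ec j, Em1 => - (- lam j *: e (Ej j))
  | Ej j, Ec k => if j == k then e E0 else 0
  | Ec j, Ej k => if j == k then - e E0 else 0
  | _, _ => 0
  end.

Lemma osc_bracket_tableC a b :
  osc_bracket_table a b = - osc_bracket_table b a.
Proof.
case: a => [||j|j]; case: b => [||k|k] //=; rewrite ?oppr0 ?opprK //.
  by rewrite eq_sym; case: eqP; rewrite ?opprK ?oppr0.
by rewrite eq_sym; case: eqP; rewrite ?opprK ?oppr0.
Qed.

Lemma osc_bracket_table_jacobi (br : V -> V -> V)
    (brr : forall x, linear (br x))
    (br_e : forall a b, br (e a) (e b) = osc_bracket_table a b) a b c :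
  br (e a) (br (e b) (e c)) + br (e b) (br (e c) (e a))
    + br (e c) (br (e a) (e b)) = 0.
Proof.
have br0 x : br x 0 = 0.
  by have := brr x (-1) 0 0; rewrite scaler0 addr0 scaleN1r addNr.
have brZ x k y : br x (k *: y) = k *: br x y.
  by have := brr x k y 0; rewrite !addr0 br0 addr0.
have brN x y : br x (- y) = - br x y by rewrite -scaleN1r brZ scaleN1r.
have br_if x (t : bool) y : br x (if t then y else 0) = if t then br x y else 0.
  by case: t.
rewrite !br_e.
case: a => [||i|i]; case: b => [||j|j]; case: c => [||k|k] /=;
  rewrite ?br_if ?(brN, brZ, br0, br_e) /= ?(brN, brZ, br0, br_e) /=
    ?if_same ?(oppr0, scaler0, addr0, add0r) //.
all: rewrite ?if_same ?(subrr, addNr) //.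
all: rewrite 1?eq_sym; case: eqP => [->|_];
  by rewrite ?(scaler0, oppr0, addr0, scaleNr, scalerN, opprK, subrr, addNr).
Qed.

End OscTable.

(* Vectors are coordinate families in the basis; the parameter lambda only
   serves to select the bracket. *)
Definition oscillator (R : realType) (n : nat) (lambda : 'rV[R]_n) : Type :=
  {ffun osc_index n -> R[i]}.

Lemma ffun_basis_expand (F : fieldType) (I : finType) (x : {ffun I -> F^o}) :
  x = \sum_a x a *: [ffun b => (b == a)%:R].
Proof.
apply/ffunP => b; rewrite sum_ffunE (bigD1 b) //= !ffunE eqxx.
rewrite big1 ?addr0 => [|a /negbTE ab]; first by rewrite /GRing.scale /= mulr1.
by rewrite !ffunE eq_sym ab scaler0.
Qed.

Section Oscillator.
Variables (R : realType) (n : nat) (lambda : 'rV[R]_n).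
Local Notation L := (oscillator lambda).
Local Notation lam j := ((lambda 0 j)%:C)%C.

HB.instance Definition _ :=
  GRing.Lmodule.copy L {ffun osc_index n -> R[i]}.

Lemma osc_addE (x y : L) a : (x + y) a = x a + y a.
Proof. by rewrite ffunE. Qed.

Lemma osc_scaleE (c : R[i]) (x : L) a : (c *: x) a = c * x a.
Proof. by rewrite ffunE. Qed.

Definition osc_basis (a : osc_index n) : L := [ffun b => (b == a)%:R].
Local Notation e := osc_basis.
Local Notation osc_table := (osc_bracket_table (fun j => lam j) osc_basis).

Definition osc_lie (x y : L) : L :=
  \sum_a \sum_b (x a * y b) *: osc_table a b.

Lemma osc_basis_expand (x : L) : x = \sum_a x a *: e a.
Proof. exact: ffun_basis_expand. Qed.

Lemma osc_lie_linearl y : linear (osc_lie^~ y).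
Proof.
move=> c u v; rewrite /osc_lie scaler_sumr -big_split; apply: eq_bigr => a _.
rewrite scaler_sumr -big_split; apply: eq_bigr => b _ /=.
by rewrite !ffunE mulrDl scalerDl -mulrA scalerA.
Qed.

Lemma osc_lie_linearr x : linear (osc_lie x).
Proof.
move=> c u v; rewrite /osc_lie scaler_sumr -big_split; apply: eq_bigr => a _.
rewrite scaler_sumr -big_split; apply: eq_bigr => b _ /=.
by rewrite !ffunE mulrDr scalerDl mulrCA scalerA.
Qed.

Lemma osc_lieC x y : osc_lie x y = - osc_lie y x.
Proof.
rewrite /osc_lie exchange_big -sumrN; apply: eq_bigr => a _ /=.
by rewrite -sumrN; apply: eq_bigr => b _; rewrite osc_bracket_tableC scalerN mulrC.
Qed.

Lemma osc_liexx x : osc_lie x x = 0.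
Proof.
have /eqP := osc_lieC x x; rewrite -addr_eq0 -mulr2n -scaler_nat.
by rewrite scaler_eq0 pnatr_eq0 => /eqP.
Qed.

Lemma linear_eq0 (f : L -> L) :
  linear f -> (forall a, f (e a) = 0) -> forall x, f x = 0.
Proof.
move=> lf f0 x.
pose fl := GRing.isLinear.Build R[i] L L *:%R f lf.
pose g : {linear L -> L} := HB.pack f fl.
rewrite (osc_basis_expand x) -[f]/(g : L -> L) linear_sum big1 // => a _.
by rewrite linearZ /= f0 scaler0.
Qed.

Lemma osc_lie_basis a b : osc_lie (e a) (e b) = osc_table a b.
Proof.
rewrite /osc_lie (bigD1 a) //= (bigD1 b) //= !ffunE !eqxx mulr1 scale1r.
rewrite big1 ?addr0 => [|c /negbTE cb]; last by rewrite !ffunE cb mulr0 scale0r.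
rewrite big1 ?addr0 // => c /negbTE ca.
by rewrite big1 // => d _; rewrite !ffunE ca mul0r scale0r.
Qed.

Let jac x y z :=
  osc_lie x (osc_lie y z) + osc_lie y (osc_lie z x) + osc_lie z (osc_lie x y).

Let jac_cycle x y z : jac x y z = jac y z x.
Proof. by rewrite /jac [RHS]addrC addrA. Qed.

Let jac_linear y z : linear (fun x => jac x y z).
Proof.
move=> c u v; rewrite /jac !(osc_lie_linearl, osc_lie_linearr) !scalerDr.
have add3 (a a' b b' d d' : L) :
    a + a' + (b + b') + (d + d') = a + b + d + (a' + b' + d').
  by rewrite (addrACA a) (addrACA (a + b)).
exact: add3.
Qed.

Let jac_basis a b c : jac (e a) (e b) (e c) = 0.
Proof. exact: (osc_bracket_table_jacobi osc_lie_linearr osc_lie_basis). Qed.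

Lemma osc_lie_jacobi x y z :
  osc_lie x (osc_lie y z) + osc_lie y (osc_lie z x) + osc_lie z (osc_lie x y)
  = 0.
Proof.
rewrite -/(jac x y z).
move: x; apply: (linear_eq0 (jac_linear y z)) => a.
rewrite jac_cycle; move: y; apply: (linear_eq0 (jac_linear z _)) => b.
rewrite jac_cycle; move: z; apply: (linear_eq0 (jac_linear _ _)) => c.
by rewrite jac_basis.
Qed.

HB.instance Definition _ := Lmodule_isLieAlgebra.Build R[i] L
  osc_lie_linearl osc_lie_linearr osc_liexx osc_lie_jacobi.

Lemma lie_osc_basis a b : [[e a, e b]] = osc_table a b.
Proof. exact: osc_lie_basis. Qed.

End Oscillator.

(* Main.v *)
Require Import Defs.
From mathcomp Require Import all_boot all_order all_algebra.
From mathcomp Require Import reals complex.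
From mathcomp Require Import ring lra.

(** The element h = e_{-1} separates half-derivations: a half-derivation D with
    D h = 0 vanishes ([half_derivation_eq0]).  This settles the 2-local
    question at once.  If nabla is 2-local, every pair (h, x) provides a
    half-derivation D_x with D_x h = nabla h and D_x x = nabla x; all the D_x
    agree at h, hence they are one and the same map D, and nabla = D
    ([two_local_half_derivation_determined]).

    For the separation property, suppose D h = 0.  Then
    D [h, x] = [h, D x] / 2, that is, 2 D o ad h = ad h o D.  The square of
    ad h is diagonal in the standard basis: it multiplies the vectors e_j and
    check e_j by - lambda_j ^ 2, and kills e_{-1} and e_0.  Comparing
    coordinates, D (e a) can only involve basis vectors whose frequency is
    exactly twice that of e a ([half_derivation_freq]).  Such resonances do
    occur, when lambda_k = 2 lambda_j, and the relation with h alone does not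
    exclude them.  They are excluded by the Heisenberg part: e_a commutes with
    the partner e_b' of e_b whenever a and b differ, so
    [e_a, D e_b'] = [e_b', D e_a], and the e_0-coordinate of this equation
    relates the b-coordinate of D e_a to the a'-coordinate of D e_b'.  The
    first needs lambda_b = 2 lambda_a to be nonzero, the second
    lambda_a = 2 lambda_b; both cannot hold for positive frequencies.  Hence D
    kills all e_j and check e_j ([half_derivation_Heisenberg_eq0]), and e_0 as
    well because e_0 = [e_1, check e_1]. *)

Set Implicit Arguments.
Unset Strict Implicit.
Unset Printing Implicit Defensive.

Import Order.TTheory GRing.Theory Num.Theory.
Local Open Scope ring_scope.

(** * Half-derivations determined by one value *)

Section HalfDerivation.
Variables (F : numFieldType) (L : lieAlgType F).

Lemma half_derivation_sub (D1 D2 : L -> L) :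
  half_derivation D1 -> half_derivation D2 ->
  half_derivation (fun x => D1 x - D2 x).
Proof.
move=> [lin1 der1] [lin2 der2]; split=> [c x y|x y].
  by rewrite lin1 lin2 scalerBr opprD addrACA.
rewrite der1 der2 -scalerBr; congr (_ *: _).
rewrite (zmod_morphism_linear (lie_linearl y)).
by rewrite (zmod_morphism_linear (lie_linearr x)) opprD addrACA.
Qed.

(** Pairing h with x forces the half-derivation that computes nabla x to take
    the value nabla h at h, so it cannot depend on x. *)
Lemma two_local_half_derivation_determined (h : L) :
  (forall D : L -> L, half_derivation D -> D h = 0 -> forall x, D x = 0) ->
  forall nabla : L -> L,
    two_local_half_derivation nabla -> half_derivation nabla.
Proof.
move=> D0 nabla nablaP; have [D [derD nablah _] ] := nablaP h h.
have nablaE : nabla =1 D.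
  move=> x; have [D' [derD' nablah' ->] ] := nablaP h x.
  apply/eqP; rewrite -subr_eq0; apply/eqP.
  apply: (D0 _ (half_derivation_sub derD' derD)).
  by rewrite -nablah' -nablah subrr.
have [linD lieD] := derD.
by split=> [c x y|x y]; rewrite !nablaE ?linD ?lieD.
Qed.

End HalfDerivation.

(** * Coordinates of brackets in the oscillator algebra *)

Section Oscillator.
Variables (R : realType) (n : nat) (lambda : 'rV[R]_n).
Local Notation L := (oscillator lambda).
Local Notation e := (@osc_basis R n lambda).
Local Notation lam j := ((lambda 0 j)%:C)%C.
Local Notation table := (osc_bracket_table (fun j => lam j) e).

Lemma lieC (x y : L) : [[x, y]] = - [[y, x]].
Proof. exact: osc_lieC. Qed.

Lemma osc_basisE a b : e a b = (b == a)%:R.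
Proof. by rewrite ffunE. Qed.

Lemma Ej_eq (j k : 'I_n) : (Ej j == Ej k) = (j == k).
Proof. by apply/eqP/eqP => [ []|->]. Qed.

Lemma Ec_eq (j k : 'I_n) : (Ec j == Ec k) = (j == k).
Proof. by apply/eqP/eqP => [ []|->]. Qed.

(** In the bracket table each basis vector is reached from a given a by at most
    one b, so coordinates of ad (e a) involve a single coordinate of v. *)
Lemma lie_basis_coord a b c (v : L) :
  (forall b', b' != b -> (table a b' : L) c = 0) ->
  [[e a, v]] c = v b * (table a b : L) c.
Proof.
move=> tab0; have -> : [[e a, v]] = \sum_b v b *: table a b.
  rewrite -[LHS]/(osc_lie (e a) v) /osc_lie (bigD1 a) //=.
  rewrite [X in _ + X]big1 => [|a' /negbTE a'a].
    by rewrite addr0; apply: eq_bigr => b' _; rewrite ffunE eqxx mul1r.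
  by rewrite big1 // => b' _; rewrite ffunE a'a mul0r scale0r.
rewrite sum_ffunE (bigD1 b isT) /= [X in _ + X]big1 => [|b' b'b].
  by rewrite addr0 osc_scaleE.
by rewrite osc_scaleE tab0 // mulr0.
Qed.

Lemma lie_Em1_Em1 (v : L) : [[e Em1, v]] Em1 = 0.
Proof.
rewrite (@lie_basis_coord _ Em1) => [|[||j|j] _] /=;
  by rewrite ?osc_scaleE ?osc_basisE ?ffunE ?mulr0.
Qed.

Lemma lie_Em1_E0 (v : L) : [[e Em1, v]] E0 = 0.
Proof.
rewrite (@lie_basis_coord _ Em1) => [|[||j|j] _] /=;
  by rewrite ?osc_scaleE ?osc_basisE ?ffunE ?mulr0.
Qed.

Lemma lie_Em1_Ej (v : L) k : [[e Em1, v]] (Ej k) = - lam k * v (Ec k).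
Proof.
rewrite (@lie_basis_coord _ (Ec k)) => [|[||j|j] ] /=.
- by rewrite osc_scaleE osc_basisE eqxx mulr1 mulrC.
- by rewrite ffunE.
- by rewrite ffunE.
- by rewrite osc_scaleE osc_basisE mulr0.
- rewrite Ec_eq osc_scaleE osc_basisE Ej_eq eq_sym.
  by move=> /negbTE->; rewrite mulr0.
Qed.

Lemma lie_Em1_Ec (v : L) k : [[e Em1, v]] (Ec k) = lam k * v (Ej k).
Proof.
rewrite (@lie_basis_coord _ (Ej k)) => [|[||j|j] ] /=.
- by rewrite osc_scaleE osc_basisE eqxx mulr1 mulrC.
- by rewrite ffunE.
- by rewrite ffunE.
- rewrite Ej_eq osc_scaleE osc_basisE Ec_eq eq_sym.
  by move=> /negbTE->; rewrite mulr0.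
- by rewrite osc_scaleE osc_basisE mulr0.
Qed.

Lemma lie_Ej_E0 (v : L) k : [[e (Ej k), v]] E0 = v (Ec k).
Proof.
rewrite (@lie_basis_coord _ (Ec k)) => [|[||j|j] ] /=.
- by rewrite eqxx osc_basisE eqxx mulr1.
- by rewrite ffunE osc_scaleE osc_basisE mulr0 oppr0.
- by rewrite ffunE.
- by rewrite ffunE.
- by rewrite Ec_eq eq_sym => /negbTE->; rewrite ffunE.
Qed.

Lemma lie_Ec_E0 (v : L) k : [[e (Ec k), v]] E0 = - v (Ej k).
Proof.
rewrite (@lie_basis_coord _ (Ej k)) => [|[||j|j] ] /=.
- by rewrite eqxx ffunE osc_basisE eqxx mulrN1.
- by rewrite ffunE osc_scaleE osc_basisE mulr0 oppr0.
- by rewrite ffunE.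
- by rewrite Ej_eq eq_sym => /negbTE->; rewrite ffunE.
- by rewrite ffunE.
Qed.

(** The modulus of the eigenvalues of ad e_{-1} on the plane of the basis
    vector labelled a. *)
Definition osc_freq (a : osc_index n) : R :=
  match a with Ej j | Ec j => lambda 0 j | _ => 0 end.

Lemma lie_lie_Em1_coord (v : L) a :
  [[e Em1, [[e Em1, v]] ]] a = - ((osc_freq a)%:C%C ^+ 2) * v a.
Proof.
case: a => [||k|k] /=.
- by rewrite lie_Em1_Em1 expr0n oppr0 mul0r.
- by rewrite lie_Em1_E0 expr0n oppr0 mul0r.
- by rewrite lie_Em1_Ej lie_Em1_Ec expr2 mulrA mulNr.
- by rewrite lie_Em1_Ec lie_Em1_Ej expr2 mulrA mulrN.
Qed.

Lemma lie_lie_Em1_basis a :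
  [[e Em1, [[e Em1, e a]] ]] = - ((osc_freq a)%:C%C ^+ 2) *: e a.
Proof.
apply/ffunP => b; rewrite lie_lie_Em1_coord osc_scaleE osc_basisE.
by case: eqVneq => [->|]; rewrite ?mulr0.
Qed.

(** The partner of a basis vector under the symplectic form
    (x, y) |-> [x, y]_(e_0) of the Heisenberg part; the values at the labels
    outside that part are arbitrary. *)
Definition osc_dual (a : osc_index n) : osc_index n :=
  match a with Ej j => Ec j | Ec j => Ej j | _ => a end.

Lemma osc_dualK : involutive osc_dual.
Proof. by case. Qed.

Lemma osc_freq_dual a : osc_freq (osc_dual a) = osc_freq a.
Proof. by case: a. Qed.

Lemma lie_basis_E0_eq0 a (v : L) : 0 < osc_freq a ->
  [[e a, v]] E0 = 0 <-> v (osc_dual a) = 0.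
Proof.
case: a => [||k|k] /=; rewrite ?ltxx // => _.
  by rewrite lie_Ej_E0.
by rewrite lie_Ec_E0; split=> [/eqP|->]; rewrite ?oppr_eq0 ?oppr0 // => /eqP.
Qed.

Lemma lie_basis_dual_eq0 a b : 0 < osc_freq a -> 0 < osc_freq b ->
  a != b -> [[e a, e (osc_dual b)]] = 0.
Proof.
move=> fa fb ab; apply: etrans (lie_osc_basis _ _ _) _.
by case: a b fa fb ab => [||j|j] [||k|k] /=;
  rewrite ?ltxx ?Ej_eq ?Ec_eq // => _ _ /negbTE->.
Qed.

(** * Half-derivations killing the first basis vector *)

Section Vanishing.
Variable D : L -> L.
Hypotheses (derD : half_derivation D) (D_Em1 : D (e Em1) = 0).

Let linD : linear D := derD.1.
Let lieD := derD.2.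

Let DZ c x : D (c *: x) = c *: D x.
Proof. exact: (scalable_linear linD). Qed.

Let D_0 : D 0 = 0.
Proof. by have := DZ 0 0; rewrite !scale0r. Qed.

Let lie0l y : [[0 : L, y]] = 0.
Proof.
by have := zmod_morphism_linear (lie_linearl y) 0 0; rewrite !subr0 /= subrr.
Qed.

Let lie0r x : [[x, 0 : L]] = 0.
Proof. by rewrite lieC lie0l oppr0. Qed.

Lemma half_derivation_lie_Em1 x : D [[e Em1, x]] = 2^-1 *: [[e Em1, D x]].
Proof. by rewrite lieD D_Em1 lie0l add0r. Qed.

(** The e_0-coordinate of D [e_a, e_b] = 0. *)
Lemma half_derivation_lie_E0 a b : [[e a, e b]] = 0 ->
  [[e a, D (e b)]] E0 = [[e b, D (e a)]] E0.
Proof.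
move=> ab0; have := lieD (e a) (e b); rewrite ab0 D_0 => /ffunP/(_ E0)/esym/eqP.
rewrite osc_scaleE [X in _ == X]ffunE mulf_eq0 invr_eq0 pnatr_eq0 /= osc_addE.
by rewrite (lieC (D _)) ffunE addrC subr_eq0 => /eqP.
Qed.

Hypothesis lambda_gt0 : forall j, 0 < lambda 0 j.

(** The square T of ad e_{-1} satisfies 4 D T = T D and is diagonal with
    eigenvalues - (osc_freq a)^2; taking square roots uses that
    frequencies are nonnegative. *)
Lemma half_derivation_freq a b :
  D (e a) b != 0 -> osc_freq b = 2 * osc_freq a.
Proof.
move=> Dab_neq0.
have freq_ge0 c : 0 <= osc_freq c by case: c => [||j|j] //=; exact: ltW.
have Dxx : D [[e Em1, [[e Em1, e a]] ]]
    = (2^-1 * 2^-1) *: [[e Em1, [[e Em1, D (e a)]] ]].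
  rewrite (half_derivation_lie_Em1 [[e Em1, e a]]).
  rewrite (half_derivation_lie_Em1 (e a)).
  by rewrite (scalable_linear (lie_linearr (e Em1))) scalerA.
have DxxE : - ((osc_freq a)%:C%C ^+ 2) *: D (e a)
    = (2^-1 * 2^-1) *: [[e Em1, [[e Em1, D (e a)]] ]].
  by rewrite -DZ -Dxx lie_lie_Em1_basis.
have freqE :
    - ((osc_freq a)%:C%C ^+ 2) = 2^-1 * 2^-1 * - ((osc_freq b)%:C%C ^+ 2).
  apply: (mulIf Dab_neq0); apply: etrans (esym (osc_scaleE _ _ _)) _.
  apply: etrans (congr1 (fun x : L => x b) DxxE) _.
  apply: etrans (osc_scaleE _ _ _) _.
  exact: etrans (congr1 _ (lie_lie_Em1_coord _ _)) (mulrA _ _ _).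
suff /eqP : osc_freq b ^+ 2 = (2 * osc_freq a) ^+ 2.
  by rewrite eqrXn2 ?mulr_ge0 // => /eqP.
apply: (@complexI R); rewrite !rmorphXn rmorphM /= rmorph_nat.
move: freqE; set f := ((osc_freq a)%:C)%C; set g := ((osc_freq b)%:C)%C => freqE.
have -> : g ^+ 2 = - 4 * (2^-1 * 2^-1 * - g ^+ 2) by field.
by rewrite -freqE; ring.
Qed.

(** A nonzero b-coordinate of D e_a is a resonance lambda_b = 2 lambda_a.  The
    relation D [e_a, e_b'] = 0, with b' the partner of b, transports it to the
    a'-coordinate of D e_b', which could only be nonzero if
    lambda_a = 2 lambda_b. *)
Lemma half_derivation_Heisenberg_eq0 a : 0 < osc_freq a -> D (e a) = 0.
Proof.
move=> fa_gt0; apply/ffunP => b; rewrite [RHS]ffunE; apply/eqP.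
apply: contraT => Dab_neq0.
have fb := half_derivation_freq Dab_neq0.
have fb_gt0 : 0 < osc_freq b by rewrite fb mulr_gt0.
have a_neq_b : a != b.
  by apply/eqP => ab; move: fb fa_gt0; rewrite -ab; lra.
have Db'a'_eq0 : D (e (osc_dual b)) (osc_dual a) = 0.
  apply/eqP; apply: contraT => /half_derivation_freq.
  by rewrite !osc_freq_dual fb => fa; move: fa_gt0; lra.
have ab'_eq0 := lie_basis_dual_eq0 fa_gt0 fb_gt0 a_neq_b.
have b'a_E0 : [[e (osc_dual b), D (e a)]] E0 = 0.
  apply: etrans (esym (half_derivation_lie_E0 ab'_eq0)) _.
  exact/(lie_basis_E0_eq0 _ fa_gt0).
have fb'_gt0 : 0 < osc_freq (osc_dual b) by rewrite osc_freq_dual.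
have := (lie_basis_E0_eq0 (D (e a)) fb'_gt0).1 b'a_E0.
by rewrite osc_dualK => Dab_eq0; rewrite Dab_eq0 eqxx in Dab_neq0.
Qed.

Lemma half_derivation_eq0 : (0 < n)%N -> forall x, D x = 0.
Proof.
have DEj j : D (e (Ej j)) = 0.
  by apply: half_derivation_Heisenberg_eq0; exact: lambda_gt0.
have DEc j : D (e (Ec j)) = 0.
  by apply: half_derivation_Heisenberg_eq0; exact: lambda_gt0.
move=> n_gt0; apply: (linear_eq0 linD) => -[||//|//]; first exact: D_Em1.
pose j := Ordinal n_gt0.
have -> : e E0 = [[e (Ej j), e (Ec j)]].
  apply: esym; apply: etrans (lie_osc_basis _ _ _) _.
  by rewrite /osc_bracket_table eqxx.
by rewrite lieD DEj DEc lie0l lie0r addr0 scaler0.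
Qed.

End Vanishing.

End Oscillator.

Theorem theorem20 (R : realType) (n : nat) (lambda : 'rV[R]_n)
    (n_gt0 : (0 < n)%N)
    (lambda_gt0 : forall j : 'I_n, 0 < lambda 0 j)
    (lambda_le : forall j k : 'I_n, (j <= k)%N -> lambda 0 j <= lambda 0 k)
    (nabla : oscillator lambda -> oscillator lambda) :
  two_local_half_derivation nabla -> half_derivation nabla.
Proof.
apply: (@two_local_half_derivation_determined _ _ (osc_basis lambda Em1)).
by move=> D derD D_Em1; exact: half_derivation_eq0.
Qed.
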